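(* Let $E\subseteq\mathbb R^{+}$. Then $E$ is a CSP-set (completely strongly porous at $0$) if and only if there are $q>1$ and a strictly decreasing sequence $\{x_n\}_{n\in\mathbb N}$ with $x_n>0$ for $n\in\mathbb N$ such that $$\lim_{n\to\infty}\frac{x_{n+1}}{x_n}=0\quad\text{and}\quad E\sqsubseteq W(q),$$ where $$W(q):=\bigcup_{n\in\mathbb N}(q^{-1}x_n,\,qx_n).$$
   Context: $\mathbb R^{+}=[0,\infty)$ with the standard topology. For $A,B\subseteq\mathbb R^{+}$, $A\sqsubseteq B$ means that there is $t=t(A,B)>0$ with $A\cap(0,t)\subseteq B\cap(0,t)$. For $E\subseteq\mathbb R^{+}$, $Ext\,E$ is the exterior of $E$ relative to $\mathbb R^{+}$. A real sequence $\{\tau_n\}$ is almost decreasing if $\tau_{n+1}\le\tau_n$ for all sufficiently large $n$. $\tilde E_0^{d}$ is the set of almost decreasing sequences $\tilde\tau=\{\tau_n\}_{n\in\mathbb N}$ with $\tau_n\in E\setminus\{0\}$ for all $n$ and $\lim_n\tau_n=0$. $\tilde I_E$ is the set of sequences $\{(a_n,b_n)\}_{n\in\mathbb N}$ of open intervals $(a_n,b_n)\subseteq\mathbb R^{+}$ such that every $a_n>0$; every $(a_n,b_n)$ is a connected component of $Ext\,E$ (that is, $(a_n,b_n)\cap E=\varnothing$, and every open interval $(a,b)\supseteq(a_n,b_n)$ with $(a,b)\ne(a_n,b_n)$ meets $E$); $\lim_n a_n=0$; and $\lim_n (b_n-a_n)/b_n=1$. For sequences of strictly positive numbers, $\{a_n\}\asymp\{\gamma_n\}$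 means that there are constants $c_1,c_2>0$ with $c_1a_n\le\gamma_n\le c_2a_n$ for all sufficiently large $n$. For $\tilde\gamma\in\tilde E_0^{d}$, $E$ is $\tilde\gamma$-strongly porous if there is $\{(a_n,b_n)\}\in\tilde I_E$ with $\tilde\gamma\asymp\{a_n\}$. $E$ is completely strongly porous at $0$ (a CSP-set) if it is $\tilde\gamma$-strongly porous for every $\tilde\gamma\in\tilde E_0^{d}$ (in particular whenever $\tilde E_0^{d}=\varnothing$). *)

(* Defs.v *)
From mathcomp Require Import all_boot all_order all_algebra.
From mathcomp Require Import all_classical all_reals all_analysis.
From mathcomp Require Import lra.
Set Implicit Arguments.
Unset Strict Implicit.
Unset Printing Implicit Defensive.
Import Order.TTheory GRing.Theory Num.Theory.
Import numFieldNormedType.Exports.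
Local Open Scope classical_set_scope.
Local Open Scope ring_scope.

Definition Rplus {R : realType} : set R := `[0, +oo[.

Definition germ_subset {R : realType} (A B : set R) : Prop :=
  exists2 t : R, 0 < t & A `&` `]0, t[ `<=` B `&` `]0, t[.

(* Since Rplus is closed in R, the closure of a subset of Rplus relative to
   Rplus is its closure in R. *)
Definition Ext {R : realType} (E : set R) : set R := Rplus `\` closure E.

Definition is_component {T : topologicalType} (A C : set T) : Prop :=
  (connected_component A @` A) C.

Definition almost_decreasing {R : realType} (tau : R^nat) : Prop :=
  \forall n \near \oo, tau n.+1 <= tau n.

Definition E0d {R : realType} (E : set R) : set (R^nat) :=
  [set tau | [/\ almost_decreasing tau,
                 forall n, (E `\ 0) (tau n)
               & tau @ \oo --> (0 : R)]].

(* The sequence of intervals (a_n, b_n) is encoded by its endpoints a and b.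
   Components are nonempty, so a n < b n is implied. *)
Definition IE {R : realType} (E : set R) : set (R^nat * R^nat) :=
  [set ab | let: (a, b) := ab in
    [/\ forall n, 0 < a n,
        forall n, is_component (Ext E) `]a n, b n[%classic,
        a @ \oo --> (0 : R)
      & (b n - a n) / b n @[n --> \oo] --> (1 : R)]].

Definition seq_equiv {R : realType} (a g : R^nat) : Prop :=
  exists c1 c2 : R, [/\ 0 < c1, 0 < c2
    & \forall n \near \oo, c1 * a n <= g n <= c2 * a n].

Definition strongly_porous_wrt {R : realType} (g : R^nat) (E : set R) : Prop :=
  exists a b : R^nat, IE E (a, b) /\ seq_equiv g a.

Definition CSP {R : realType} (E : set R) : Prop :=
  forall g : R^nat, E0d E g -> strongly_porous_wrt g E.

Definition W {R : realType} (x : R^nat) (q : R) : set R :=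
  \bigcup_n `]q^-1 * x n, q * x n[%classic.

Lemma ball_disjoint_closure {R : realType} (E : set R) (y : R) :
  ~ closure E y ->
  exists2 e : R, 0 < e & forall z, y - e < z < y + e -> ~ E z.
Proof.
move=> nEy; have : nbhs y (~` closure E).
  by apply: open_nbhs_nbhs; split => //; exact/closed_openC/closed_closure.
case/nbhs_ballP => e /= e0 ye; exists e => // z zye Ez.
apply: (ye z); last exact: subset_closure.
by rewrite -ball_normE /= ltr_distlC.
Qed.

Lemma oitv_disjoint_closure {R : realType} (E : set R) (c d : R) :
  `]c, d[ `&` E = set0 -> `]c, d[ `&` closure E = set0.
Proof.
move=> cdE; rewrite -subset0 => z [cdz /(_ `]c, d[%classic)] [|y [Ey cdy]].
  by apply: open_nbhs_nbhs; split => //; exact: interval_open.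
by rewrite -[set0 _]/(set0 y) -cdE.
Qed.

(* The order-theoretic description of the components of Ext E off 0. *)
Lemma is_component_ExtP {R : realType} (E : set R) (a b : R) : 0 < a ->
  is_component (Ext E) `]a, b[%classic <->
  [/\ a < b, `]a, b[ `&` E = set0
    & forall c d : R, `]a, b[ `<` `]c, d[ -> `]c, d[ `&` E !=set0].
Proof.
move=> a0; split.
- move=> [x Ax Cx].
  have xab : `]a, b[%classic x.
    by rewrite -Cx; exact: connected_component_refl.
  have /andP[ax xb] : a < x < b by move: xab; rewrite /= in_itv.
  have abA : `]a, b[ `<=` Ext E by rewrite -Cx; exact: connected_component_sub.
  split; first exact: lt_trans xb.
    rewrite -subset0 => y [/abA[_ nEy] Ey]; apply: nEy.
    exact: subset_closure.
  move=> c d [abcd ncd]; apply/set0P/negP => /eqP cdE; apply: ncd.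
  have := abcd _ xab; rewrite /= in_itv /= => /andP[cx xd].
  have Bab : `]Num.max c 0, d[ `<=` `]a, b[.
    rewrite -Cx; apply: connected_component_max.
    + by rewrite /= in_itv /= gt_max cx xd (lt_trans a0 ax).
    + move=> y; rewrite /= in_itv /= gt_max => /andP[/andP[cy y0] yd].
      split; first by rewrite /Rplus /= in_itv /= (ltW y0).
      move=> Ey; have : (`]c, d[ `&` closure E) y.
        by split => //; rewrite /= in_itv /= cy.
      by rewrite oitv_disjoint_closure.
    + exact/connected_intervalP/interval_is_interval.
  move=> y; rewrite /= in_itv /= => /andP[cy yd].
  have [y0|y0] := ltP 0 y.
    by apply: Bab; rewrite /= in_itv /= gt_max cy y0.
  have /Bab : `]Num.max c 0, d[%classic (a / 2).
    by rewrite /= in_itv /= gt_max; apply/andP; split; [apply/andP; split|]; lra.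
  by rewrite /= in_itv /= => /andP[]; lra.
- move=> [ab abE abmax].
  have abA : `]a, b[ `<=` Ext E.
    move=> y aby; split.
      by move: aby; rewrite /Rplus /= !in_itv /= => /andP[]; lra.
    move=> Ey; have : (`]a, b[ `&` closure E) y by [].
    by rewrite oitv_disjoint_closure.
  have abx : `]a, b[%classic ((a + b) / 2).
    by rewrite /= in_itv /=; apply/andP; split; lra.
  exists ((a + b) / 2); first exact: abA.
  set C := connected_component _ _.
  have Ci : is_interval C by exact/connected_intervalP/component_connected.
  have CA : C `<=` Ext E by exact: connected_component_sub.
  have Cx : C ((a + b) / 2) by apply: connected_component_refl; exact: abA.
  have max c d : c <= a -> b <= d -> (c < a) || (b < d) ->
      exists2 z, c < z < d & E z.
    move=> ca bd cabd; have [|z []] := abmax c d.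
      split=> [y|cdab].
        by rewrite /= !in_itv /= => /andP[? ?]; apply/andP; split; lra.
      case/orP: cabd => [ca'|bd'].
        have /cdab : `]c, d[%classic a.
          by rewrite /= in_itv /= ca' (lt_le_trans ab).
        by rewrite /= in_itv /= ltxx.
      have /cdab : `]c, d[%classic b.
        by rewrite /= in_itv /= bd' (le_lt_trans ca).
      by rewrite /= in_itv /= ltxx andbF.
    by rewrite /= in_itv /=; exists z.
  have nE z : a < z < b -> ~ E z.
    by move=> abz Ez; have : (`]a, b[ `&` E) z by []; rewrite abE.
  apply/seteqP; split; last first.
    by apply: connected_component_max => //;
      exact/connected_intervalP/interval_is_interval.
  move=> y Cy; rewrite /= in_itv /=; apply/andP; split; rewrite ltNge;
    apply/negP => yab.
  + have /CA[_ /ball_disjoint_closure[e e0 He]] : C a.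
      by apply: (Ci _ _ Cy Cx); apply/andP; split; lra.
    have [|||z /andP[z1 z2] Ez] := max (a - e) b; [lra|lra|apply/orP; left; lra|].
    have [za|za] := ltP a z; first by apply: (nE z) => //; rewrite za.
    by apply: (He z) => //; apply/andP; split; lra.
  + have /CA[_ /ball_disjoint_closure[e e0 He]] : C b.
      by apply: (Ci _ _ Cx Cy); apply/andP; split; lra.
    have [|||z /andP[z1 z2] Ez] := max a (b + e); [lra|lra|apply/orP; right; lra|].
    have [zb|zb] := ltP z b; first by apply: (nE z) => //; rewrite z1.
    by apply: (He z) => //; apply/andP; split; lra.
Qed.

(* Main.v *)
Require Import Defs.
From mathcomp Require Import all_boot all_order all_algebra.
From mathcomp Require Import all_classical all_reals all_analysis.
From mathcomp Require Import ring lra.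
Import Order.TTheory GRing.Theory Num.Theory.
Import numFieldNormedType.Exports.
Local Open Scope classical_set_scope.
Local Open Scope ring_scope.

(** Both properties are equivalent to a condition that mentions no sequence,
    [uniformly_porous E M] for some M > 1: for every K, each point e of E close
    enough to 0 has a component (a, b) of the exterior with a within a factor M
    of e and b >= K a. The factor M does not depend on K, only the meaning of
    close enough does.

    Complete strong porosity gives a uniform M by diagonalization
    ([CSP_uniformly_porous]): if no M = k + 2 works, with K_k witnessing the
    failure, a single sequence of points of E can visit bad points for every k
    infinitely often. Any sequence of components attached to it has some constant
    M = k + 2, and then b < K_k a infinitely often, so a / b does not tend to 0.

    The converse ([uniformly_porous_CSP]) and the construction of x both rest on
    a separation principle: if a < a' are left endpoints of components (a, b) and
    (a', b'), then b <= a'. Hence left endpoints of components with b >= K a are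
    pairwise a factor K apart, and for K large compared with M the component
    attached to a point does not depend on K ([wide_gap_unique]). One choice
    of components therefore serves all K at once.

    Separation also makes the left endpoints of the wide components a discrete
    subset of (0, oo), so they can be listed in decreasing order as
    x_0 > x_1 > ... ([separated_set_has_predecessor]). Every point of E near 0 is
    within a factor M of some x_n, which gives the cover W(q), and x_n bounds from
    above the right endpoint of the component starting at x_{n+1}, so the
    ratio x_{n+1} / x_n tends to 0 ([uniformly_porous_lacunary_cover]).
    Conversely, given the cover, a point of E in the window around x_{p+1} is
    followed by the empty interval (q x_{p+1}, x_p / q), which extends to a
    component as wide as desired ([lacunary_cover_uniformly_porous]). *)

(** * Components of the exterior and wide gaps *)

Lemma component_avoids {R : realType} {E : set R} {a b z : R} : 0 < a ->
  is_component (Ext E) `]a, b[%classic -> a < z -> z < b -> ~ E z.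
Proof.
move=> a0 /(is_component_ExtP E b a0)[_ abE _] az zb Ez.
suff : (`]a, b[ `&` E) z by rewrite abE.
by split=> //=; rewrite in_itv /= az.
Qed.

Lemma component_maximal {R : realType} {E : set R} {a b c d : R} : 0 < a ->
  is_component (Ext E) `]a, b[%classic -> c <= a -> b <= d ->
  c < a \/ b < d -> exists2 z, E z & c < z < d.
Proof.
move=> a0 /(is_component_ExtP E b a0)[ab _ abmax] ca bd cabd.
have [|z [zcd Ez]] := abmax c d; last by exists z => //; rewrite /= in_itv in zcd.
split=> [y|cdab].
  by rewrite /= !in_itv /= => /andP[? ?]; apply/andP; split; lra.
case: cabd => [ca'|bd'].
  have /cdab : `]c, d[%classic a.
    by rewrite /= in_itv /= ca' (lt_le_trans ab).
  by rewrite /= in_itv /= ltxx.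
have /cdab : `]c, d[%classic b by rewrite /= in_itv /= bd' (le_lt_trans ca).
by rewrite /= in_itv /= ltxx andbF.
Qed.

Lemma component_lt {R : realType} {E : set R} {a b : R} : 0 < a ->
  is_component (Ext E) `]a, b[%classic -> a < b.
Proof. by move=> a0 /(is_component_ExtP E b a0)[]. Qed.

(** By maximality (c, b) meets E, and it can do so only outside (a, b). Left
    endpoints of components are thus adherent to the part of E up to them, which
    is what allows to compare components through points of E. *)
Lemma component_left_adherent {R : realType} {E : set R} {a b c : R} : 0 < a ->
  is_component (Ext E) `]a, b[%classic -> c < a -> exists2 e, E e & c < e <= a.
Proof.
move=> a0 comp ca.
have [|e Ee /andP[ce eb]] := component_maximal a0 comp (ltW ca) (lexx b).
  by left.
exists e => //; rewrite ce leNgt; apply/negP => ae.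
exact: component_avoids a0 comp ae eb Ee.
Qed.

Lemma component_ordered {R : realType} {E : set R} {a b a' b' : R} :
  0 < a -> is_component (Ext E) `]a, b[%classic ->
  0 < a' -> is_component (Ext E) `]a', b'[%classic -> a < a' -> b <= a'.
Proof.
move=> a0 comp a'0 comp' aa'.
have [e Ee /andP[ae ea']] := component_left_adherent a'0 comp' aa'.
rewrite leNgt; apply/negP => a'b.
by apply: (component_avoids a0 comp ae _ Ee); apply: le_lt_trans a'b.
Qed.

Lemma component_right_unique {R : realType} {E : set R} {a b b' : R} : 0 < a ->
  is_component (Ext E) `]a, b[%classic ->
  is_component (Ext E) `]a, b'[%classic -> b = b'.
Proof.
move=> a0.
have le (d d' : R) : is_component (Ext E) `]a, d[%classic ->
    is_component (Ext E) `]a, d'[%classic -> d' <= d.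
  move=> comp comp'; rewrite leNgt; apply/negP => dd'.
  have [|e Ee /andP[ae ed']] := component_maximal a0 comp (lexx a) (ltW dd').
    by right.
  exact: component_avoids a0 comp' ae ed' Ee.
by move=> comp comp'; apply/eqP; rewrite eq_le !le.
Qed.

(** The component runs from the supremum of the part of E below the empty interval
    to the infimum of the part above; the points e1 and e2 of E keep its left
    endpoint positive and its right endpoint finite. *)
Lemma gap_extends_to_component {R : realType} {E : set R} {e1 c d e2 : R} :
  0 < e1 -> e1 <= c -> c < d -> d <= e2 -> E e1 -> E e2 ->
  (forall z, c < z -> z < d -> ~ E z) ->
  exists a b : R, [/\ e1 <= a, a <= c, d <= b &
    is_component (Ext E) `]a, b[%classic].
Proof.
move=> e10 e1c cd de2 Ee1 Ee2 cdE.
pose L := [set z | E z /\ z <= c]; pose U := [set z | E z /\ d <= z].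
have Lub : ubound L c by move=> z [].
have Ulb : lbound U d by move=> z [].
have L0 : L !=set0 by exists e1.
have U0 : U !=set0 by exists e2.
have supL : has_sup L by split=> //; exists c.
have infU : has_inf U by split=> //; exists d.
have e1a : e1 <= sup L by apply: sup_upper_bound.
have ac : sup L <= c by apply: ge_sup.
have db : d <= inf U by apply: lb_le_inf.
have abE z : E z -> sup L < z -> z < inf U -> False.
  move=> Ez az zb; have [zc|cz] := leP z c.
    have : z <= sup L by apply: sup_upper_bound.
    lra.
  have [dz|zd] := leP d z; last exact: (cdE z).
  have : inf U <= z by apply: ge_inf => //; exists d.
  lra.
exists (sup L), (inf U); split=> //.
apply/is_component_ExtP; first lra.
split; first lra.
  rewrite -subset0 => z [/=]; rewrite in_itv /= => /andP[? ?] Ez.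
  exact: (abE z).
move=> x y [abxy nxyab].
set a := sup L in ac abE abxy nxyab *; set b := inf U in db abE abxy nxyab *.
have ab : a < b by lra.
have [xa ylb] : x <= a /\ b <= y.
  (* otherwise some point of (a, b) lies to the left of x or to the right
     of y *)
  split; rewrite leNgt; apply/negP => lt.
    have [w /andP[aw wxb]] : exists w, a < w < Num.min x b.
      exists ((a + Num.min x b) / 2).
      have : a < Num.min x b by rewrite lt_min lt.
      by move=> ?; apply/andP; split; lra.
    move: wxb; rewrite lt_min => /andP[wx wb].
    have /abxy : `]a, b[%classic w by rewrite /= in_itv /= aw.
    by rewrite /= in_itv /= => /andP[]; lra.
  have [w /andP[aw wxb]] : exists w, Num.max y a < w < b.
    exists ((Num.max y a + b) / 2).
    have : Num.max y a < b by rewrite gt_max lt.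
    by move=> ?; apply/andP; split; lra.
  move: aw; rewrite gt_max => /andP[wy wa].
  have /abxy : `]a, b[%classic w by rewrite /= in_itv /= wa.
  by rewrite /= in_itv /= => /andP[]; lra.
have [xa'|ax] := ltP x a.
  have [|e [Ee ec] ae] := sup_adherent (_ : 0 < a - x) supL; first lra.
  have ea : e <= a by apply: sup_upper_bound.
  exists e; split=> //; rewrite /= in_itv /=.
  by apply/andP; split; move: ae; rewrite -/a => ?; lra.
have [yb|yb] := ltP b y.
  have [|e [Ee ec] ae] := inf_adherent (_ : 0 < y - b) infU; first lra.
  have be : b <= e by apply: ge_inf => //; exists d.
  exists e; split=> //; rewrite /= in_itv /=.
  by apply/andP; split; move: ae; rewrite -/b => ?; lra.
exfalso; apply: nxyab => z.
by rewrite /= !in_itv /= => /andP[? ?]; apply/andP; split; lra.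
Qed.

Definition wide_gap {R : realType} (E : set R) (K a b : R) : Prop :=
  [/\ 0 < a, is_component (Ext E) `]a, b[%classic & K * a <= b].

Lemma wide_gapW {R : realType} {E : set R} {K K' a b : R} :
  K' <= K -> wide_gap E K a b -> wide_gap E K' a b.
Proof.
by move=> KK' [a0 comp Kab]; split=> //; apply: le_trans Kab; rewrite ler_pM2r.
Qed.

Lemma wide_gap_separated {R : realType} {E : set R} {K K' a b a' b' : R} :
  wide_gap E K a b -> wide_gap E K' a' b' -> a < a' -> K * a <= a'.
Proof.
move=> [a0 comp Kab] [a'0 comp' _] aa'.
exact: le_trans Kab (component_ordered a0 comp a'0 comp' aa').
Qed.

(** Two wide gaps with different left endpoints have them more than a factor
    c apart, because the whole of the lower gap lies between them. *)
Lemma wide_gap_unique {R : realType} {E : set R} {K c a b a' b' : R} :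
  wide_gap E K a b -> wide_gap E K a' b' -> c < K ->
  a <= c * a' -> a' <= c * a -> a = a' /\ b = b'.
Proof.
move=> g g' cK aca' a'ca; have [a0 comp _] := g; have [a'0 comp' _] := g'.
have aa' : a = a'.
  have lt (u v : R) : 0 < u -> v <= c * u -> K * u <= v -> False.
    move=> u0 vcu Kuv; have : c * u < K * u by rewrite ltr_pM2r.
    by lra.
  case: (ltgtP a a') => [h|h|->] //; exfalso.
    exact: lt a0 a'ca (wide_gap_separated g g' h).
  exact: lt a'0 aca' (wide_gap_separated g' g h).
split=> //; rewrite -aa' in comp'; exact: component_right_unique a0 comp comp'.
Qed.

(** The order of the quantifiers is the point: M is chosen before K. *)
Definition uniformly_porous {R : realType} (E : set R) (M : R) : Prop :=
  forall K : R, exists2 t : R, 0 < t &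
    forall e, E e -> 0 < e < t ->
      exists a b, [/\ wide_gap E K a b, e <= M * a & a <= M * e].

(** * Uniform porosity and complete strong porosity *)

Lemma pos_of_nonzero {R : realType} {E : set R} {z : R} :
  E `<=` Rplus -> (E `\ 0) z -> 0 < z.
Proof.
move=> EP [/EP]; rewrite /Rplus /= in_itv /= andbT => z0 /eqP zn0.
by rewrite lt_neqAle eq_sym zn0.
Qed.

Lemma cvg0_eventually_lt {R : realType} {u : R^nat} {t : R} :
  u @ \oo --> (0 : R) -> 0 < t ->
  exists N, forall n, (N <= n)%N -> u n < t.
Proof.
move=> /cvgrPdist_lt u0 t0; have [N _ uN] := u0 _ t0.
exists N => n /uN /=; rewrite sub0r normrN; apply: le_lt_trans.
exact: ler_norm.
Qed.

Lemma cvg0_of_eventually_le {R : realType} {u : R^nat} : (forall n, 0 <= u n) ->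
  (forall t, 0 < t -> exists N, forall n, (N <= n)%N -> u n <= t) ->
  u @ \oo --> (0 : R).
Proof.
move=> u_ge0 u_le; apply/cvgrPdist_le => t /u_le[N uN].
by exists N => // n /= /uN; rewrite sub0r normrN ger0_norm.
Qed.

(** The component attached to g n for the fixed width K0 > M ^ 2 coincides, for n
    large, with the one attached for any prescribed larger width, hence b n / a n
    is eventually above every bound. *)
Lemma uniformly_porous_CSP {R : realType} {E : set R} {M : R} :
  E `<=` Rplus -> 1 < M -> uniformly_porous E M -> CSP E.
Proof.
move=> EP M1 unif g [_ Eg g0].
have M0 : 0 < M by lra.
have gpos n : 0 < g n by exact: pos_of_nonzero EP (Eg n).
pose K0 := M ^+ 2 + 1.
have [t0 t0_gt0 gapK0] := unif K0.
have [N0 gN0] := cvg0_eventually_lt g0 t0_gt0.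
(* the index is shifted to at least N0, since a component is needed for every n
   while porosity is known only near 0 *)
have /choice[ab abP] : forall n, exists ab : R * R,
    [/\ wide_gap E K0 ab.1 ab.2, g (maxn n N0) <= M * ab.1
      & ab.1 <= M * g (maxn n N0)].
  move=> n; have [|a [b abP]] := gapK0 _ (Eg (maxn n N0)).1; last by exists (a, b).
  by rewrite gpos gN0 // leq_maxr.
have wide K : exists N, forall n, (N <= n)%N -> K * (ab n).1 <= (ab n).2.
  have [t t_gt0 gapK] := unif (Num.max K K0).
  have [N1 gN1] := cvg0_eventually_lt g0 t_gt0.
  exists (maxn N0 N1) => n; rewrite geq_max => /andP[N0n N1n].
  have [] := abP n; rewrite (maxn_idPl N0n) => wab ga ag.
  have [|a [b [wab' ga' ag']]] := gapK _ (Eg n).1; first by rewrite gpos gN1.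
  have /(wide_gap_unique wab) : wide_gap E K0 a b.
    by apply: wide_gapW wab'; rewrite le_max lexx orbT.
  case/(_ (M ^+ 2)) => [|||-> ->].
  - by rewrite /K0; lra.
  - apply: le_trans ag _; rewrite expr2 -mulrA ler_pM2l //.
  - apply: le_trans ag' _; rewrite expr2 -mulrA ler_pM2l //.
  have [|_ _ //] := @wide_gapW _ E _ K a b _ wab'.
  by rewrite le_max lexx.
have a_gt0 n : 0 < (ab n).1 by have [[]] := abP n.
have ab_lt n : (ab n).1 < (ab n).2 by have [[a0 /(component_lt a0)]] := abP n.
exists (fun n => (ab n).1), (fun n => (ab n).2); split; [split=> //|].
- by move=> n; have [[]] := abP n.
- apply: cvg0_of_eventually_le => [n|t t_gt0]; first exact: ltW.
  have [|N gN] := @cvg0_eventually_lt _ g (t / M) g0; first exact: divr_gt0.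
  exists N => n Nn; have [_ _ /le_trans-> //] := abP n.
  rewrite mulrC -ler_pdivlMr //; apply: ltW; apply: gN.
  by rewrite leq_max Nn.
- apply/cvgrPdist_le => t t_gt0; have [N wN] := wide t^-1.
  exists N => // n /= /wN; have := ab_lt n; have := a_gt0 n.
  move: (ab n).1 (ab n).2 => a b a0 ltab Kab.
  have b0 : 0 < b by lra.
  have -> : 1 - (b - a) / b = a / b by field; lra.
  rewrite ger0_norm; last by rewrite divr_ge0 // ltW.
  by rewrite ler_pdivrMr // mulrC -ler_pdivrMr // mulrC.
- exists M^-1, M; split => //; first by rewrite invr_gt0.
  exists N0 => // n /= N0n; have [_] := abP n.
  rewrite (maxn_idPl N0n) => ga ag.
  by rewrite ag andbT mulrC ler_pdivrMr // mulrC.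
Qed.

Lemma frequently_each_nat (k N : nat) : exists2 n, (N <= n)%N & logn 2 n.+1 = k.
Proof.
have pos : (0 < 2 ^ k * (N.*2.+1))%N by rewrite muln_gt0 expn_gt0.
exists (2 ^ k * N.*2.+1).-1.
  rewrite -ltnS prednK //; apply: leq_trans (leq_pmull _ _).
    by rewrite ltnS -addnn leq_addr.
  by rewrite expn_gt0.
rewrite prednK // lognM ?expn_gt0 // pfactorK // [X in (_ + X)%N]logn_coprime ?addn0 //.
by rewrite coprime2n /= odd_double.
Qed.

(** Diagonalization over M = k + 2. Each k must be visited infinitely often: which
    k contradicts porosity depends on the comparison constants of g and a, and the
    contradiction for that k needs terms arbitrarily far in the sequence. *)
Lemma CSP_uniformly_porous {R : realType} {E : set R} :
  CSP E -> exists2 M : R, 1 < M & uniformly_porous E M.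
Proof.
move=> csp; apply: contrapT => not_unif.
pose bad (M K e : R) := forall a b, wide_gap E K a b ->
  e <= M * a -> a <= M * e -> False.
have /choice[K KP] : forall k : nat, exists K : R, forall t, 0 < t ->
    exists e, [/\ E e, 0 < e < t & bad k.+2%:R K e].
  move=> k; apply: contrapT => noK; apply: not_unif.
  exists k.+2%:R; first by rewrite ltr1n.
  move=> K; apply: contrapT => not_t; apply: noK; exists K => t t0.
  apply: contrapT => no_e; apply: not_t; exists t => // e Ee et.
  apply: contrapT => no_ab; apply: no_e; exists e; split=> // a b w ea ae.
  by apply: no_ab; exists a, b.
have /choice[pick pickP] : forall kt : nat * R, exists e, 0 < kt.2 ->
    [/\ E e, 0 < e < kt.2 & bad kt.1.+2%:R (K kt.1) e].
  move=> [k t] /=; have [t0|_] := ltP 0 t; last by exists 0.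
  by have [e] := KP k t t0; exists e.
(* the dyadic valuation of n + 1 takes every value infinitely often, so g is bad
   infinitely often for each k *)
pose g := fix g n : R := if n is m.+1
  then pick (logn 2 n.+1, Num.min (g m) n.+1%:R^-1) else pick (logn 2 1, 1).
have gP n : [/\ E (g n), 0 < g n <= n.+1%:R^-1
    & bad (logn 2 n.+1).+2%:R (K (logn 2 n.+1)) (g n)] /\ g n.+1 < g n.
  have step m : 0 < g m -> [/\ E (g m.+1), 0 < g m.+1 <= m.+2%:R^-1
      & bad (logn 2 m.+2).+2%:R (K (logn 2 m.+2)) (g m.+1)] /\ g m.+1 < g m.
    move=> gm0; have [|Eg /= /andP[g0]] :=
      pickP (logn 2 m.+2, Num.min (g m) m.+2%:R^-1).
      by rewrite /= lt_min gm0 invr_gt0 ltr0n.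
    by rewrite lt_min => /andP[gg gm] badg; split=> //; split=> //; rewrite g0 ltW.
  elim: n => [|n [[_ /andP[/step[IH lt] _] _] _]].
    have [//|Eg /= /andP[g0 g1] badg] := pickP (logn 2 1, 1).
    have [_ lt] := step 0%N g0.
    by split=> //; split=> //; rewrite invr1 g0 ltW.
  split=> //; have [_ /andP[g0 _] _] := IH.
  by have [] := step _ g0.
have g_gt0 n : 0 < g n by have [[_ /andP[]]] := gP n.
have [|a [b [[a0 comp _ /cvgrPdist_lt ab1] [c1 [c2 [c1_gt0 c2_gt0 [N _ gaN]]]]]]] :=
    csp g.
  split.
  - by exists 0%N => // n _; have [_ /ltW] := gP n.
  - move=> n; have [[Eg _ _] _] := gP n; split=> // /= g0.
    by have := g_gt0 n; rewrite g0 ltxx.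
  - apply: (@squeeze_cvgr _ _ _ _ (fun=> 0) harmonic); last exact: cvg_harmonic.
      by exists 0%N => // n _; have [[_ /andP[/ltW-> ->]]] := gP n.
    exact: cvg_cst.
(* this k makes the factor k + 2 at least as weak as both comparison constants *)
pose k := Num.truncn (Num.max c2 c1^-1).
have /andP[kc2 kc1] : (c2 <= k.+2%:R) && (c1^-1 <= k.+2%:R :> R).
  rewrite -ge_max; apply: (@le_trans _ _ k.+1%:R); last by rewrite ler_nat.
  by apply: ltW; rewrite truncnS_gt.
pose K1 := Num.max (K k) 1.
have K1_gt0 : 0 < K1 by rewrite lt_max ltr01 orbT.
have [|N' _ wideN] := ab1 K1^-1; first by rewrite invr_gt0.
have [n] := frequently_each_nat k (maxn N N').
rewrite geq_max => /andP[Nn N'n] lognk.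
have [[_ _]] := gP n; rewrite lognk => /(_ (a n) (b n)) + _; apply.
- split=> //; have abn := component_lt (a0 n) (comp n).
  apply: (@le_trans _ _ (K1 * a n)).
    by rewrite ler_pM2r ?a0 // le_max lexx.
  have := wideN n N'n; have := a0 n.
  move: (a n) (b n) abn => x y xy /= x0.
  have y0 : 0 < y by lra.
  have -> : 1 - (y - x) / y = x / y by field; lra.
  rewrite gtr0_norm ?divr_gt0 // ltr_pdivrMr // ltr_pdivlMl //.
  exact: ltW.
- have /andP[c1g _] := gaN n Nn; rewrite mulrC.
  apply: (@le_trans _ _ (a n * c1^-1)); last by rewrite ler_pM2l.
  by rewrite ler_pdivlMr // mulrC.
- have /andP[_ gc2] := gaN n Nn.
  by apply: le_trans gc2 _; rewrite ler_pM2r.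
Qed.

(** * Uniform porosity and lacunary sequences *)

Lemma lacunary_cvg0 {R : realType} {x : R^nat} :
  decreasing_seq x -> (forall n, 0 < x n) ->
  x n.+1 / x n @[n --> \oo] --> (0 : R) -> x @ \oo --> (0 : R).
Proof.
move=> xdec xpos ratio.
apply: cvg0_of_eventually_le => [n|t t0]; first exact: ltW.
have [|N rN] := cvg0_eventually_lt ratio (_ : 0 < t / x 0%N).
  exact: divr_gt0.
exists N.+1 => -[//|n]; rewrite ltnS => /rN; rewrite ltr_pdivrMr // => lt.
apply: (le_trans (ltW lt)); rewrite -mulrA ger_pMr // mulrC ler_pdivrMr // mul1r.
by rewrite xdec.
Qed.

(** Consecutive windows of W(q) leave between them an interval free of E whose
    endpoints have ratio q ^ 2 x_{p+1} / x_p, arbitrarily small near 0. *)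
Lemma lacunary_cover_uniformly_porous {R : realType} {E : set R} {q : R}
    {x : R^nat} :
  1 < q -> decreasing_seq x -> (forall n, 0 < x n) ->
  x n.+1 / x n @[n --> \oo] --> (0 : R) -> germ_subset E (W x q) ->
  uniformly_porous E (q ^+ 2).
Proof.
move=> q1 xdec xpos ratio [t t0 EW] K.
have q0 : 0 < q by lra.
have xle m n : (m <= n)%N -> x n <= x m by rewrite -xdec.
have [[e2 Ee2 e20]|noE] := pselect (exists2 e, E e & 0 < e); last first.
  by exists 1 => // e Ee /andP[e0 _]; case: noE; exists e.
(* x n.+1 / x n < 1 / L makes the interval between two windows wide; the maximum
   with 1 also makes these windows disjoint *)
pose L := Num.max K 1 * q ^+ 2.
have K1 : 1 <= Num.max K 1 by rewrite le_max lexx orbT.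
have L0 : 0 < L by rewrite mulr_gt0 ?exprn_gt0 //; lra.
have [|N1 rN1] := cvg0_eventually_lt ratio (_ : 0 < L^-1).
  by rewrite invr_gt0.
have x_cvg0 := lacunary_cvg0 xdec xpos ratio.
have [|N2 xN2] := cvg0_eventually_lt x_cvg0 (_ : 0 < q * Num.min t e2).
  by rewrite mulr_gt0 // lt_min t0.
pose N := maxn N1 N2.
have xN n : (N <= n)%N -> q^-1 * x n < t /\ q^-1 * x n < e2.
  rewrite geq_max => /andP[_ /xN2]; rewrite -ltr_pdivrMl // lt_min.
  by move/andP.
have gap n : (N <= n)%N -> Num.max K 1 * (q * x n.+1) < q^-1 * x n.
  rewrite geq_max => /andP[/rN1 + _].
  rewrite ltr_pdivrMr // ltr_pdivlMl // /L => lt.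
  rewrite ltr_pdivlMl //; apply: le_lt_trans lt.
  by rewrite mulrCA expr2 -!mulrA.
have cover z : E z -> 0 < z -> z < t -> exists m, q^-1 * x m < z < q * x m.
  move=> Ez z0 zt; have [|[m _ +] _] := EW z; last first.
    by rewrite /= in_itv /= => ?; exists m.
  by split=> //=; rewrite in_itv /= z0.
exists (q^-1 * x N); first by rewrite mulr_gt0 ?invr_gt0.
move=> e Ee /andP[e0 eN].
have [tN e2N] := xN N (leqnn N).
have [m /andP[xme exm]] := cover e Ee e0 (lt_trans eN tN).
have Nm : (N < m)%N.
  rewrite ltnNge; apply/negP => /xle; rewrite leNgt => /negP; apply.
  have : q^-1 * x m < q^-1 * x N by lra.
  by rewrite ltr_pM2l ?invr_gt0.
case: m Nm xme exm => // p; rewrite ltnS => Np xpe exp.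
have gp := gap p Np; have [tp e2p] := xN p Np.
have qx0 : 0 < q * x p.+1 by rewrite mulr_gt0.
have gp1 : q * x p.+1 < q^-1 * x p.
  apply: le_lt_trans gp; rewrite ler_peMl //; exact: ltW.
have [|a [b [ea ac db comp]]] :=
  gap_extends_to_component e0 (ltW exp) gp1 (ltW e2p) Ee Ee2.
  (* the windows of index at most p lie above the gap, the others below *)
  move=> z cz zd Ez; have [||j /andP[xjz zxj]] := cover z Ez; [lra|lra|].
  have [pj|jp] := ltnP p j.
    have : q * x j <= q * x p.+1 by rewrite ler_pM2l // xle.
    by lra.
  have : q^-1 * x p <= q^-1 * x j by rewrite ler_pM2l ?invr_gt0 // xle.
  by lra.
have a0 : 0 < a by lra.
exists a, b; split.
- split=> //; apply: le_trans db; apply: ltW; apply: le_lt_trans gp.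
  apply: (@le_trans _ _ (Num.max K 1 * a)).
    by rewrite ler_pM2r // le_max lexx.
  by rewrite ler_pM2l //; lra.
- by apply: le_trans ea _; rewrite ler_peMl ?(ltW a0) // expr_ge1 // ltW.
- apply: le_trans ac _; rewrite expr2 -mulrA ler_pM2l //.
  by move: xpe; rewrite ltr_pdivrMl // => /ltW.
Qed.

(** Any lacunary sequence covers a set with no points near 0; inverse factorials
    are one, shifted by one because 0! = 1!. *)
Lemma isolated_zero_lacunary_cover {R : realType} {E : set R} {t : R} :
  0 < t -> (forall e, E e -> 0 < e < t -> False) ->
  exists x : R^nat, [/\ decreasing_seq x, forall n, 0 < x n,
    x n.+1 / x n @[n --> \oo] --> (0 : R) & germ_subset E (W x 2)].
Proof.
move=> t0 noE.
have f0 n : (0 : R) < n`!%:R by rewrite ltr0n fact_gt0.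
exists (fun n => n.+1`!%:R^-1); split.
- apply/decreasing_seqP => n.
  by rewrite ltf_pV2 ?posrE // ltr_nat [X in (_ < X)%N]factS ltn_Pmull ?fact_gt0.
- by move=> n; rewrite invr_gt0.
- have -> : (fun n => n.+2`!%:R^-1 / n.+1`!%:R^-1) = [sequence harmonic n.+1]_n :> R^nat.
    apply/funext => n /=; rewrite factS natrM invrK invfM -mulrA mulVf; last first.
      exact: lt0r_neq0.
    by rewrite mulr1.
  by rewrite (cvg_shiftS (@harmonic R)); exact: cvg_harmonic.
- exists t => // e [Ee]; rewrite /= in_itv /= => /(noE e Ee) [].
Qed.

Lemma halving_seq_small {R : realType} {x : R^nat} {t : R} :
  (forall n, 0 < x n) -> (forall n, 2 * x n.+1 <= x n) -> 0 < t ->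
  exists n, x n < t.
Proof.
move=> xpos half t0.
have bnd n : n.+1%:R * x n <= x 0%N.
  elim: n => [|n IH]; first by rewrite mul1r.
  apply: le_trans IH; have := half n; have := xpos n.+1.
  have : (1 : R) <= n.+1%:R by rewrite ler1n.
  rewrite -(natr1 n.+1); move: n.+1%:R => k; nra.
exists (Num.truncn (x 0%N / t)); set n := Num.truncn _.
have : x 0%N / t < n.+1%:R by rewrite truncnS_gt.
rewrite ltr_pdivrMr // => lt; have := le_lt_trans (bnd n) lt.
by rewrite ltr_pM2l // ltr0n.
Qed.

(** An element of A above sup / k is the largest one, since any greater element
    would exceed the supremum. *)
Lemma separated_set_has_predecessor {R : realType} {A : set R} {k y : R} :
  1 < k -> (forall a, A a -> 0 < a) ->
  (forall a a', A a -> A a' -> a < a' -> k * a <= a') ->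
  (exists2 a, A a & a < y) ->
  exists a, [/\ A a, a < y & forall a', A a' -> a' < y -> a' <= a].
Proof.
move=> k1 Apos Asep [a1 Aa1 a1y].
pose B := [set a | A a /\ a < y].
have supB : has_sup B by split; [exists a1|exists y => z [_ /ltW]].
have s0 : 0 < sup B.
  by apply: lt_le_trans (Apos _ Aa1) _; apply: sup_upper_bound.
have [|a [Aa ay] sa] := sup_adherent (_ : 0 < sup B - sup B / k) supB.
  by rewrite subr_gt0 ltr_pdivrMr ?ltr_pMr //; lra.
exists a; split=> // a' Aa' a'y; rewrite leNgt; apply/negP => /(Asep _ _ Aa Aa').
have : a' <= sup B by apply: sup_upper_bound.
have : sup B < k * a.
  by move: sa; rewrite subKr ltr_pdivrMr 1?mulrC //; lra.
lra.
Qed.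

(** The sequence lists the left endpoints of the gaps of width K0 below 1. The
    value K0 > 2 M is what identifies x n.+1 with the endpoint attached, for a
    larger width, to a point of E between x n.+1 / 2 and x n.+1. *)
Lemma uniformly_porous_lacunary_cover {R : realType} {E : set R} {M : R} :
  1 < M -> uniformly_porous E M ->
  exists (q : R) (x : R^nat), [/\ 1 < q, decreasing_seq x, forall n, 0 < x n,
    x n.+1 / x n @[n --> \oo] --> (0 : R) & germ_subset E (W x q)].
Proof.
move=> M1 unif.
have [[t [t0 noE]]|acc] :=
    pselect (exists t, 0 < t /\ forall e, E e -> 0 < e < t -> False).
  have [x xP] := isolated_zero_lacunary_cover t0 noE.
  by exists 2, x; case: xP => *; split=> //; rewrite ltr1n.
have {}acc t : 0 < t -> exists2 e, E e & 0 < e < t.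
  move=> t0; apply: contrapT => no; apply: acc; exists t; split=> // e Ee et.
  by apply: no; exists e.
pose K0 := 2 * M + 1; pose A a := exists b, wide_gap E K0 a b.
have Apos a : A a -> 0 < a by move=> [b []].
have Asep a a' : A a -> A a' -> a < a' -> K0 * a <= a'.
  by move=> [b ga] [b' ga']; apply: wide_gap_separated ga ga'.
have [t0 t0_gt0 gapK0] := unif K0.
have Asmall y : 0 < y -> exists2 a, A a & a < y.
  move=> y0; have [|e Ee /andP[e0]] := acc (Num.min t0 (y / M)).
    by rewrite lt_min t0_gt0 divr_gt0 //; lra.
  rewrite lt_min => /andP[et ey].
  have [|a [b [wab _ aM]]] := gapK0 e Ee; first by rewrite e0.
  exists a; first by exists b.
  by apply: le_lt_trans aM _; rewrite mulrC -ltr_pdivlMr //; lra.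
have /choice[below belowP] : forall y, exists a, 0 < y ->
    [/\ A a, a < y & forall a', A a' -> a' < y -> a' <= a].
  move=> y; have [y0|_] := ltP 0 y; last by exists 0.
  have [|a aP] := separated_set_has_predecessor (_ : 1 < K0) Apos Asep (Asmall y y0).
    by rewrite /K0; lra.
  by exists a.
pose x n := iter n.+1 below 1.
have xA n : A (x n).
  elim: n => [|n IH]; first by have [] := belowP 1 ltr01.
  by have [] := belowP _ (Apos _ IH).
have xpos n : 0 < x n by exact: Apos.
have xlt n : x n.+1 < x n by have [] := belowP _ (xpos n).
have xmax n a : A a -> a < x n -> a <= x n.+1.
  by have [_ _ h] := belowP _ (xpos n); apply: h.
have xdec : decreasing_seq x by apply/decreasing_seqP.
have xsmall t : 0 < t -> exists N, forall n, (N <= n)%N -> x n < t.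
  move=> t_gt0; have [n||N xN] := @halving_seq_small _ x t xpos; last 1 first.
  - by exists N => n Nn; apply: le_lt_trans xN; rewrite xdec.
  - apply: (@le_trans _ _ (K0 * x n.+1)); last exact: Asep.
    by rewrite ler_pM2r // /K0; lra.
  - exact: t_gt0.
have xall a : A a -> a < x 0%N -> exists n, a = x n.
  move=> Aa ax; have [N xN] := xsmall a (Apos a Aa).
  have ex : exists n, x n <= a by exists N; exact/ltW/xN.
  case: (ex_minnP ex) => -[|n] xna xmin; first by move: xna; rewrite leNgt ax.
  exists n.+1; apply/eqP; rewrite eq_le xna andbT; apply: xmax => //.
  by rewrite ltNge; apply/negP => /xmin; rewrite ltnn.
exists (2 * M), x; split=> //.
- by lra.
- apply: cvg0_of_eventually_le => [n|r r0].
    by rewrite divr_ge0 // ltW.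
  have [t t_gt0 gapK] := unif (Num.max r^-1 K0).
  have [N xN] := xsmall t t_gt0.
  exists N => n Nn; have [b wb] := xA n.+1; have [xn0 comp _] := wb.
  (* left endpoints are adherent to E, so porosity applies near them *)
  have [|e Ee /andP[xe ex]] := component_left_adherent xn0 comp (_ : x n.+1 / 2 < x n.+1).
    by lra.
  have [|a [b' [wab' ea ae]]] := gapK e Ee.
    have := xN n.+1 (leqW Nn); lra.
  have /(wide_gap_unique wb) : wide_gap E K0 a b'.
    by apply: wide_gapW wab'; rewrite le_max lexx orbT.
  case/(_ (2 * M)) => [|||xa bb'].
  + by rewrite /K0; lra.
  + by lra.
  + apply: le_trans ae _; rewrite ler_pM //; lra.
  have wab : wide_gap E r^-1 a b'.
    by apply: wide_gapW wab'; rewrite le_max lexx.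
  have [b1 wb1] := xA n.
  rewrite ler_pdivrMr // mulrC -ler_pdivrMr // mulrC.
  by rewrite xa; apply: wide_gap_separated wab wb1 _; rewrite -xa.
- exists (Num.min t0 (x 0%N / M)).
    by rewrite lt_min t0_gt0 divr_gt0 //; lra.
  move=> e [Ee]; rewrite /= in_itv /= => eitv; split=> //.
  move: eitv; rewrite lt_min => /and3P[e0 et ex].
  have [|a [b [wab ea ae]]] := gapK0 e Ee; first by rewrite e0.
  have a0 : 0 < a by case: wab.
  have [||n an] := xall a; first by exists b.
    by apply: le_lt_trans ae _; rewrite mulrC -ltr_pdivlMr //; lra.
  exists n => //=; rewrite in_itv /= -an; apply/andP; split.
    by rewrite ltr_pdivrMl; nra.
  by nra.
Qed.

Theorem theorem3p7 (R : realType) (E : set R) (E_Rplus : E `<=` Rplus) :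
  CSP E <->
  exists (q : R) (x : R^nat),
    [/\ 1 < q,
        decreasing_seq x,
        forall n, 0 < x n,
        x n.+1 / x n @[n --> \oo] --> (0 : R)
      & germ_subset E (W x q)].
Proof.
split=> [/CSP_uniformly_porous[M M1 unif]|[q [x [q1 xdec xpos ratio EW]]]].
  exact: uniformly_porous_lacunary_cover M1 unif.
apply: (@uniformly_porous_CSP _ _ (q ^+ 2)) => //; first exact: exprn_egt1.
exact: lacunary_cover_uniformly_porous xdec xpos ratio EW.
Qed.
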